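(* (i) For every combinatorial description $[\mathcal{R}]$ (a nonempty multiset $\mathcal{R}$ of words, each of length at least $1$, over an alphabet $S\cup S^{-1}$), the complex $Y$ constructed from $[\mathcal{R}]$ is a link-connected $2$-complex. (ii) Conversely, every link-connected $2$-complex $Y$ can be constructed from a combinatorial description; that is, there exist a set $S$ and a nonempty multiset $\mathcal{R}$ of words over $S\cup S^{-1}$ such that the complex constructed from $[\mathcal{R}]$ is isomorphic (as a combinatorial cell complex) to $Y$.
   Context: A map between CW complexes is combinatorial if it restricts to a homeomorphism from each open cell of the domain onto an open cell of the target. A polygon is a closed $2$-disc whose boundary circle has been given the structure of a graph; it is an $n$-gon if the boundary cycle has $n\ge 1$ edges. All $2$-complexes are combinatorial: a $2$-complex $X$ is obtained from a graph $\Gamma$ and a collection $\mathcal{P}$ of disjoint polygons by attaching the boundary cycle of each $n$-gon along a closed combinatorial path of length $n$ in $\Gamma$. Loops and multiple edges are allowed in $\Gamma$. Let $P$ be the disjoint union of the polygons in $\mathcal{P}$ (itself a cell complex). If $X$ has no isolated vertices and every edge of $\Gamma$ lies in the image of at least one attaching map, then $X$ is a quotient of $P$ by a combinatorial map $P\twoheadrightarrow X$; in this case $X$ is called a polygon quotient. Vertex links: let $X$ be a polygon quotient with quotient map $f:P\twoheadrightarrow X$ and let $u$ be a vertex of $X$. The graph $\mathrm{Link}(u,X)$ is defined as follows. Take one closed edge for each vertex $v$ of $P$ with $f(v)=u$, and associate its two endpoints with the two ends of edges of $P$ that are attached at $v$. Then identify endpoints of these closed edges if and only if the corresponding ends of edges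 in $P$ are identified by $f$. A link-connected $2$-complex is a polygon quotient $X$ (with at least one polygon) such that $\mathrm{Link}(u,X)$ is connected for every vertex $u$ of $X$. The complex constructed from $[\mathcal{R}]$: let $P$ be a disjoint union of polygons indexed by the words in $\mathcal{R}$ (with multiplicity), a word of length $n$ corresponding to an $n$-gon. Choose a base vertex and an orientation of the boundary cycle of each polygon, and orient and label the boundary edges so that reading from the base vertex in the chosen direction spells the corresponding word (an edge labeled $s\in S$ is traversed along its orientation for the letter $s$, and against its orientation for the letter $s^{-1}$). Then $Y$ is the quotient of $P$ obtained by identifying any two edges with the same label, respecting orientations, and identifying two vertices if and only if this is forced by the edge identifications (i.e. vertices are identified according to the equivalence relation generated by identifying the initial vertices, respectively the terminal vertices, of equally labeled oriented edges). *)

(* Defs.v *)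
From Stdlib Require Import Relation_Operators.
From mathcomp Require Import all_boot boolp.

Set Implicit Arguments.
Unset Strict Implicit.
Unset Printing Implicit Defensive.

Local Open Scope quotient_scope.

(** * Quotient of a type by the equivalence relation generated by a relation *)

Definition gen_eqv (T : Type) (R : T -> T -> Prop) : rel {classic T} :=
  fun x y => `[< clos_refl_sym_trans T R x y >].

Lemma gen_eqv_refl (T : Type) (R : T -> T -> Prop) : reflexive (gen_eqv R).
Proof. by move=> x; apply/asboolP; apply: rst_refl. Qed.

Lemma gen_eqv_sym (T : Type) (R : T -> T -> Prop) : symmetric (gen_eqv R).
Proof. by move=> x y; apply: asbool_equiv_eq; split; apply: rst_sym. Qed.

Lemma gen_eqv_trans (T : Type) (R : T -> T -> Prop) : transitive (gen_eqv R).
Proof.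
by move=> y x z /asboolP xy /asboolP yz; apply/asboolP; apply: rst_trans xy yz.
Qed.

Canonical gen_eqv_equiv (T : Type) (R : T -> T -> Prop) :=
  EquivRel (gen_eqv R) (@gen_eqv_refl T R) (@gen_eqv_sym T R)
    (@gen_eqv_trans T R).

Definition quot (T : Type) (R : T -> T -> Prop) : Type := {eq_quot (gen_eqv R)}.

Definition cls (T : Type) (R : T -> T -> Prop) (x : T) : quot R :=
  \pi_({eq_quot (gen_eqv R)}) (x : {classic T}).

Definition rep (T : Type) (R : T -> T -> Prop) (q : quot R) : T :=
  repr (q : {eq_quot (gen_eqv R)}).

Lemma repK (T : Type) (R : T -> T -> Prop) (q : quot R) : cls R (rep q) = q.
Proof. exact: reprK. Qed.

Lemma clsP (T : Type) (R : T -> T -> Prop) (x y : T) :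
  cls R x = cls R y <-> clos_refl_sym_trans T R x y.
Proof.
split=> [/eqmodP/asboolP //|xy]; apply/eqmodP; exact/asboolP.
Qed.

Lemma rep_cls (T : Type) (R : T -> T -> Prop) (x : T) :
  clos_refl_sym_trans T R (rep (cls R x)) x.
Proof. by apply/clsP; rewrite repK. Qed.

(** * Graphs *)

(* Graphs in the sense of Serre: loops and multiple edges are allowed.  A dart
   is an oriented edge, an edge is a pair {d, opp d}.  Darts are also used for
   the ends of edges: d stands for the end of its edge that lies at src d. *)
Record graph := Graph {
  vertex : Type;
  dart : Type;
  src : dart -> vertex;
  opp : dart -> dart;
  oppK : involutive opp;
  opp_neq : forall d, opp d <> d }.

Definition tgt (G : graph) (d : dart G) : vertex G := src (opp d).

Definition adjacent (G : graph) (x y : vertex G) : Prop :=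
  exists d : dart G, src d = x /\ tgt d = y.

Definition graph_connected (G : graph) : Prop :=
  inhabited (vertex G) /\
  forall x y : vertex G, clos_refl_trans (vertex G) (@adjacent G) x y.

(** * Combinatorial 2-complexes *)

(* The boundary cycle of the n-gon F (n = perim F) has vertices and edges
   indexed by Z/n, the edge j joining the vertices j and j + 1 ([ordS]); it is
   attached along the closed path bd F 0, ..., bd F (n - 1). *)
Record complex2 := Complex2 {
  skel :> graph;
  face : Type;
  perim : face -> nat;
  perim_gt0 : forall F, 0 < perim F;
  bd : forall F, 'I_(perim F) -> dart skel;
  bd_closed : forall F (j : 'I_(perim F)), tgt (bd j) = src (bd (ordS j)) }.

Definition inverse_path (G : graph) (s : seq (dart G)) : seq (dart G) :=
  [seq opp d | d <- rev s].

(* A homeomorphism between open polygons that is compatible with the attaching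
   maps preserves the boundary path up to the choice of its starting point and
   of its direction. *)
Record cmap (X Y : complex2) := CMap {
  vmap : vertex X -> vertex Y;
  dmap : dart X -> dart Y;
  fmap : face X -> face Y;
  cmap_src : forall d, src (dmap d) = vmap (src d);
  cmap_opp : forall d, dmap (opp d) = opp (dmap d);
  cmap_bd : forall F : face X, exists k : nat,
    let s := [seq dmap d | d <- codom (@bd X F)] in
    let t := codom (@bd Y (fmap F)) in
    s = rot k t \/ s = rot k (inverse_path t) }.

Definition isomorphic (X Y : complex2) : Prop :=
  exists f : cmap X Y,
    [/\ bijective (vmap f), bijective (dmap f) & bijective (fmap f)].

(** * Disjoint unions of polygons *)

Section Polygons.
Variables (I : Type) (n : I -> nat).
Hypothesis n_gt0 : forall i, 0 < n i.

(* A corner is a vertex j of the polygon i; it is also used to denote the edge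
   from the vertex j to the vertex j + 1 of that polygon. *)
Definition corner : Type := {i : I & 'I_(n i)}.
Definition next (v : corner) : corner := existT _ (tag v) (ordS (tagged v)).
Definition prev (v : corner) : corner := existT _ (tag v) (ord_pred (tagged v)).

(* (e, false) is the edge e directed from e to next e, (e, true) is the edge e
   in the opposite direction. *)
Definition poly_src (d : corner * bool) : corner :=
  if d.2 then next d.1 else d.1.
Definition poly_opp (d : corner * bool) : corner * bool := (d.1, ~~ d.2).

Lemma poly_oppK : involutive poly_opp.
Proof. by case=> e b; rewrite /poly_opp /= negbK. Qed.

Lemma poly_opp_neq d : poly_opp d <> d.
Proof. by case: d => e []. Qed.

Definition polygons_graph : graph := Graph poly_src poly_oppK poly_opp_neq.

Definition poly_bd (i : I) (j : 'I_(n i)) : dart polygons_graph :=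
  (existT _ i j, false).

Lemma poly_bd_closed (i : I) (j : 'I_(n i)) :
  tgt (poly_bd j) = src (poly_bd (ordS j)).
Proof. by []. Qed.

Definition polygons : complex2 := Complex2 n_gt0 poly_bd_closed.

(* The two ends of edges attached at the vertex v. *)
Definition corner_end (v : corner) (b : bool) : corner * bool :=
  if b then (prev v, true) else (v, false).

Lemma corner_endP (v : corner) (d : corner * bool) :
  poly_src d = v <-> exists b, d = corner_end v b.
Proof.
split=> [<-|[b ->]]; last first.
  by case: b v => [] [i j] //=; rewrite /poly_src /next /= ord_predK.
by case: d => -[i j] b; exists b; case: b; rewrite /= /prev /= ?ordSK.
Qed.

End Polygons.

(** * Polygon quotients *)

Definition polygons_of (X : complex2) : complex2 := polygons (@perim_gt0 X).

Definition attach_vertex (X : complex2) (v : vertex (polygons_of X)) :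
    vertex X :=
  src (bd (tagged v)).

Definition attach_dart (X : complex2) (d : dart (polygons_of X)) : dart X :=
  if d.2 then opp (bd (tagged d.1)) else bd (tagged d.1).

Lemma attach_src (X : complex2) (d : dart (polygons_of X)) :
  src (attach_dart d) = attach_vertex (src d).
Proof. by case: d => -[i j] [] //; exact: bd_closed. Qed.

Lemma attach_opp (X : complex2) (d : dart (polygons_of X)) :
  attach_dart (opp d) = opp (attach_dart d).
Proof. by case: d => e []; rewrite //= /attach_dart /= oppK. Qed.

Lemma attach_bd (X : complex2) (F : face (polygons_of X)) : exists k : nat,
  let s := [seq attach_dart d | d <- codom (@bd (polygons_of X) F)] in
  let t := codom (@bd X F) in
  s = rot k t \/ s = rot k (inverse_path t).
Proof. by exists 0; left; rewrite rot0 !codomE -map_comp. Qed.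

Definition attach (X : complex2) : cmap (polygons_of X) X :=
  CMap (@attach_src X) (@attach_opp X) (@attach_bd X).

Definition polygon_quotient (X : complex2) : Prop :=
  (forall v : vertex X, exists d : dart X, src d = v) /\
  (forall d : dart X, exists (F : face X) (j : 'I_(perim F)),
      d = bd j \/ d = opp (bd j)).

(** * Vertex links *)

Section Link.
Variables (X : complex2) (u : vertex X).

Definition link_corner : Type :=
  {v : vertex (polygons_of X) | vmap (attach X) v = u}.

Definition link_end : Type :=
  {d : dart (polygons_of X) | vmap (attach X) (src d) = u}.

Definition same_end (d d' : link_end) : Prop :=
  dmap (attach X) (sval d) = dmap (attach X) (sval d').

Lemma link_corner_end_subproof (v : link_corner) (b : bool) :
  vmap (attach X) (@src (polygons_of X) (corner_end (sval v) b)) = u.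
Proof.
case: v => v /= vu; rewrite -[RHS]vu; congr attach_vertex.
by apply/corner_endP; exists b.
Qed.

Definition link_corner_end (v : link_corner) (b : bool) : link_end :=
  exist _ (corner_end (sval v) b) (link_corner_end_subproof v b).

Definition link_src (d : link_corner * bool) : quot same_end :=
  cls same_end (link_corner_end d.1 d.2).
Definition link_opp (d : link_corner * bool) : link_corner * bool :=
  (d.1, ~~ d.2).

Lemma link_oppK : involutive link_opp.
Proof. by case=> e b; rewrite /link_opp /= negbK. Qed.

Lemma link_opp_neq d : link_opp d <> d.
Proof. by case: d => e []. Qed.

(* One edge for each corner at u, whose two endpoints are the classes of the
   two ends of edges attached at this corner. *)
Definition link : graph := Graph link_src link_oppK link_opp_neq.

End Link.

Definition link_connected (X : complex2) : Prop :=
  [/\ inhabited (face X), polygon_quotient X &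
      forall u : vertex X, graph_connected (link u)].

(** * Combinatorial descriptions *)

(* The letter (s, false) stands for s and (s, true) for s^-1.  A multiset of
   words is a family of words indexed by an arbitrary, possibly infinite,
   type. *)
Record description := Description {
  alphabet : Type;
  index : Type;
  word : index -> seq (alphabet * bool);
  index_inhabited : inhabited index;
  word_gt0 : forall i, 0 < size (word i) }.

Section Construction.
Variable R : description.

(* The vertex 0 of each polygon is its base vertex, and its increasing
   direction is the chosen one. *)
Definition word_polygons : complex2 := polygons (@word_gt0 R).
Local Notation P := word_polygons.
Local Notation edge := (corner (fun i : index R => size (word i))).

Definition letter (e : edge) : alphabet R * bool :=
  tnth (in_tuple (word (tag e))) (tagged e).
Definition label (e : edge) : alphabet R := (letter e).1.

(* The edge e with the orientation of its label: it is traversed backwards when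
   it is read as an inverse letter. *)
Definition oriented (e : edge) : dart P := (e, (letter e).2).

Definition dart_glue (d d' : dart P) : Prop :=
  exists e e' : edge, label e = label e' /\
    ((d = oriented e /\ d' = oriented e') \/
     (d = opp (oriented e) /\ d' = opp (oriented e'))).

Definition vertex_glue (v v' : vertex P) : Prop :=
  exists e e' : edge, label e = label e' /\
    ((v = src (oriented e) /\ v' = src (oriented e')) \/
     (v = tgt (oriented e) /\ v' = tgt (oriented e'))).

Definition built_src (d : quot dart_glue) : quot vertex_glue :=
  cls vertex_glue (src (rep d)).
Definition built_opp (d : quot dart_glue) : quot dart_glue :=
  cls dart_glue (opp (rep d)).

Lemma dart_glue_src (d d' : dart P) :
  clos_refl_sym_trans _ dart_glue d d' ->
  clos_refl_sym_trans _ vertex_glue (src d) (src d').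
Proof.
elim=> {d d'} [d d' [e [e' [ee' H]]]|d|d d' _|d d' d'' _ H _].
- by apply: rst_step; exists e, e'; split=> //; case: H => -[-> ->]; auto.
- exact: rst_refl.
- exact: rst_sym.
- exact: rst_trans H.
Qed.

Lemma dart_glue_opp (d d' : dart P) :
  clos_refl_sym_trans _ dart_glue d d' ->
  clos_refl_sym_trans _ dart_glue (opp d) (opp d').
Proof.
elim=> {d d'} [d d' [e [e' [ee' H]]]|d|d d' _|d d' d'' _ H _].
- apply: rst_step; exists e, e'; split=> //.
  by case: H => -[-> ->]; rewrite ?oppK; auto.
- exact: rst_refl.
- exact: rst_sym.
- exact: rst_trans H.
Qed.

Lemma dart_glue_sign (d d' : dart P) :
  clos_refl_sym_trans _ dart_glue d d' ->
  d.2 (+) (letter d.1).2 = d'.2 (+) (letter d'.1).2.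
Proof.
elim=> {d d'} [d d' [e [e' [_ H]]]|d|d d' _|d d' d'' _ -> _] //.
by case: H => -[-> ->] /=; rewrite ?addNb ?addbb.
Qed.

Lemma built_srcE (d : dart P) :
  built_src (cls dart_glue d) = cls vertex_glue (src d).
Proof. by apply/clsP/dart_glue_src/rep_cls. Qed.

Lemma built_oppE (d : dart P) :
  built_opp (cls dart_glue d) = cls dart_glue (opp d).
Proof. by apply/clsP/dart_glue_opp/rep_cls. Qed.

Lemma built_oppK : involutive built_opp.
Proof. by move=> d; rewrite -[d]repK !built_oppE oppK. Qed.

Lemma built_opp_neq d : built_opp d <> d.
Proof.
rewrite -[d]repK built_oppE => /clsP/dart_glue_sign /=.
by rewrite addNb; case: addb.
Qed.

Definition built_graph : graph := Graph built_src built_oppK built_opp_neq.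

Definition built_bd (i : index R) (j : 'I_(size (word i))) : dart built_graph :=
  cls dart_glue (@bd P i j).

Lemma built_bd_closed (i : index R) (j : 'I_(size (word i))) :
  tgt (built_bd j) = src (built_bd (ordS j)).
Proof. by rewrite /tgt /= built_oppE !built_srcE. Qed.

Definition built : complex2 := Complex2 (@word_gt0 R) built_bd_closed.

End Construction.

(* Main.v *)
(** A generating identification of vertices of the polygons is between the
    starting points of two identified darts, that is, between two corners whose
    edges in the link share an endpoint: so the corners over a vertex of the
    constructed complex form one component of the link.  Conversely, label edges
    of the polygons of [Y] by their images in [Y], each with a chosen
    orientation.  The darts of the polygons are then identified as in [Y], and
    an edge path in the link of a vertex [u] of [Y] shows that any two corners
    over [u] are forced to be identified. *)

Require Import Defs.
From Stdlib Require Import Relation_Operators.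
From mathcomp Require Import all_boot boolp.

Set Implicit Arguments.
Unset Strict Implicit.
Unset Printing Implicit Defensive.

(** * Bijections, generated equivalences and casts of ordinals *)

Lemma inj_surj_bij (A B : Type) (f : A -> B) :
  injective f -> (forall y, exists x, f x = y) -> bijective f.
Proof.
move=> f_inj f_surj; pose g y := sval (cid (f_surj y)).
have gK : cancel g f by move=> y; rewrite /g; case: cid.
by exists g => // x; apply: f_inj; rewrite gK.
Qed.

Lemma clos_rst_image (T U : Type) (R : T -> T -> Prop) (f : T -> U) :
  (forall x y, R x y -> f x = f y) ->
  forall x y, clos_refl_sym_trans T R x y -> f x = f y.
Proof.
by move=> fR x y; elim=> {x y} [x y /fR||x y _ ->|x y z _ -> _ ->].
Qed.

Lemma codom_cast_ord (m n : nat) (T : Type) (e : m = n) (f : 'I_n -> T) :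
  codom (fun j : 'I_m => f (cast_ord e j)) = codom f.
Proof. by case: n / e f => f; apply: eq_codom => j; rewrite cast_ord_id. Qed.

Lemma ordS_cast_ord (m n : nat) (e : m = n) (j : 'I_m) :
  ordS (cast_ord e j) = cast_ord e (ordS j).
Proof. by case: n / e; rewrite !cast_ord_id. Qed.

(** * Paths in graphs and in vertex links *)

Section GraphPaths.
Variable G : graph.

Lemma adjacent_sym (x y : vertex G) : adjacent x y -> adjacent y x.
Proof. by case=> d [<- <-]; exists (opp d); rewrite /tgt oppK. Qed.

Lemma path_sym (x y : vertex G) :
  clos_refl_trans _ (@adjacent G) x y -> clos_refl_trans _ (@adjacent G) y x.
Proof.
elim=> {x y} [x y /adjacent_sym|x|x y z _ xy _ yz].
- exact: rt_step.
- exact: rt_refl.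
- exact: rt_trans yz xy.
Qed.

End GraphPaths.

Lemma attach_dart_surj (X : complex2) :
  polygon_quotient X -> forall d : dart X, exists p, @attach_dart X p = d.
Proof.
case=> _ X_edge d; have [F [j [->|->]]] := X_edge d.
- by exists (existT _ F j, false).
- by exists (existT _ F j, true).
Qed.

Section Link.
Variables (X : complex2) (u : vertex X).

(** Only two ends lie at a corner, and they are the endpoints of the link edge of that corner: the
    two given ends are equal or adjacent. *)
Lemma link_path_corner (d d' : link_end u) :
  src (sval d) = src (sval d') ->
  clos_refl_trans _ (@adjacent (link u)) (cls (@same_end X u) d)
    (cls (@same_end X u) d').
Proof.
move=> dd'; have v_u : vmap (attach X) (src (sval d)) = u by case: (d).
pose v : link_corner u := exist _ _ v_u.
have endE (c : link_end u) : src (sval c) = src (sval d) ->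
    exists b, cls (@same_end X u) c = link_src (v, b).
  move=> /corner_endP [b cb]; exists b.
  by apply/clsP/rst_step; rewrite /same_end cb.
have [[b ->] [b' ->]] := (endE d erefl, endE d' (esym dd')).
have [<-|bb'] := eqVneq b b'; first exact: rt_refl.
apply: rt_step; exists ((v, b) : dart (link u)).
by rewrite /tgt /= /link_opp /=; case: b b' bb' => [] [].
Qed.

Lemma rep_same_end (d : link_end u) :
  dmap (attach X) (sval (rep (cls (@same_end X u) d))) = dmap (attach X) (sval d).
Proof.
pose f (l : link_end u) := dmap (attach X) (sval l).
by apply: (@clos_rst_image _ _ (@same_end X u) f) (rep_cls _ _).
Qed.

End Link.

(** * Connectedness of the links of a constructed complex *)

Section BuiltLinkConnected.
Variable R : description.
Local Notation P := (word_polygons R).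

Lemma attach_dart_built (d : dart P) :
  @attach_dart (built R) d = cls (@dart_glue R) d.
Proof. by case: d => -[i j] [] //; rewrite /attach_dart /= built_oppE. Qed.

Lemma attach_vertex_built (v : vertex P) :
  @attach_vertex (built R) v = cls (@vertex_glue R) v.
Proof. by case: v => i j; rewrite /attach_vertex /= built_srcE. Qed.

(** Identified darts are a single vertex of the link, so this turns each generating identification
    of corners into a common endpoint of their link edges. *)
Lemma vertex_glueE (v v' : vertex P) : vertex_glue v v' ->
  exists d d' : dart P, [/\ src d = v, src d' = v' & dart_glue d d'].
Proof.
case=> e [e' [ee' [[-> ->]|[-> ->]]]].
- by exists (oriented e), (oriented e'); split=> //; exists e, e'; auto.
- exists (opp (oriented e)), (opp (oriented e')).
  by split=> //; exists e, e'; auto.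
Qed.

Lemma built_link_path (u : vertex (built R)) (v v' : vertex P) :
  clos_refl_sym_trans _ (@vertex_glue R) v v' ->
  forall d d' : link_end u, src (sval d) = v -> src (sval d') = v' ->
  clos_refl_trans _ (@adjacent (link u)) (cls (@same_end _ u) d)
    (cls (@same_end _ u) d').
Proof.
elim=> {v v'} [v v' vv'|v|v v' _ IH|v w v' vw IHv _ IHv'] d d' dv d'v'.
- have [c [c' [cv c'v' cc']]] := vertex_glueE vv'.
  have c_u : vmap (attach (built R)) (@src (polygons_of (built R)) c) = u.
    by rewrite cv -dv; case: (d).
  have c'_u : vmap (attach (built R)) (@src (polygons_of (built R)) c') = u.
    by rewrite c'v' -d'v'; case: (d').
  pose lc : link_end u := exist _ c c_u.
  pose lc' : link_end u := exist _ c' c'_u.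
  have lcE : cls (@same_end _ u) lc = cls (@same_end _ u) lc'.
    apply/clsP/rst_step; rewrite /same_end /= !attach_dart_built.
    exact/clsP/rst_step.
  apply: rt_trans (link_path_corner (d' := lc) (etrans dv (esym cv))) _.
  rewrite lcE; apply: link_path_corner; exact: etrans c'v' (esym d'v').
- by apply: link_path_corner; exact: etrans dv (esym d'v').
- exact/path_sym/IH.
(* Transitivity needs an end at the middle corner [w], which lies over [u] because it is identified
   with [v]. *)
- have w_u : vmap (attach (built R)) (@src (polygons_of (built R)) (w, false)) = u.
    rewrite /= attach_vertex_built -(proj2 (clsP _ _ _) vw) -dv.
    by rewrite -attach_vertex_built; case: (d).
  by apply: rt_trans (IHv d (exist _ (w, false) w_u) _ _) (IHv' _ _ _ _).
Qed.

Lemma built_polygon_quotient : polygon_quotient (built R).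
Proof.
split=> [v|d].
- by exists (cls _ (rep v, false)); rewrite /= built_srcE repK.
- rewrite -[d]repK; case: (rep d) => -[i j] [].
  + by exists i, j; right; rewrite /= built_oppE.
  + by exists i, j; left.
Qed.

Lemma built_link_connected : link_connected (built R).
Proof.
split; [exact: index_inhabited|exact: built_polygon_quotient|move=> u; split].
- have v_u : vmap (attach (built R)) (rep u) = u.
    by rewrite /= attach_vertex_built repK.
  by split; exact: (link_src (exist _ (rep u) v_u : link_corner u, false)).
- move=> x y; rewrite -[x]repK -[y]repK.
  apply: built_link_path erefl erefl; apply/clsP.
  rewrite -!attach_vertex_built.
  by case: (rep x) (rep y) => [c c_u] [c' c'_u]; rewrite /= in c_u c'_u *; rewrite c_u.
Qed.

End BuiltLinkConnected.

(** * Choice of an orientation for each edge of a graph *)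

Section Orientation.
Variable G : graph.

Definition opposite (d d' : dart G) : Prop := d' = opp d.
Definition edge_of (d : dart G) : quot opposite := cls opposite d.
(** The representative of the class of an edge serves as its chosen orientation. *)
Definition reversed (d : dart G) : bool := `[< rep (edge_of d) <> d >].

Lemma edge_of_opp (d : dart G) : edge_of (opp d) = edge_of d.
Proof. by apply/clsP/rst_sym/rst_step. Qed.

Lemma edge_ofP (d d' : dart G) : edge_of d = edge_of d' -> d' = d \/ d' = opp d.
Proof.
move/clsP; elim=> {d d'} [d d' ->|d|d d' _|d c d' _ dc _].
- by right.
- by left.
- by case=> ->; rewrite ?oppK; auto.
- by case: dc => -> [] ->; rewrite ?oppK; auto.
Qed.

Lemma rep_edge_of (d : dart G) :
  rep (edge_of d) = if reversed d then opp d else d.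
Proof.
rewrite /reversed; case: asboolP => [rep_neq|/contrapT //].
by have [//|//] := @edge_ofP d (rep (edge_of d)) (esym (repK _)).
Qed.

(** Both darts have the same representative, so equal values of [reversed] would force
    [opp d = d]. *)
Lemma reversed_opp (d : dart G) : reversed (opp d) = ~~ reversed d.
Proof.
have := rep_edge_of (opp d); rewrite edge_of_opp rep_edge_of oppK.
by case: (reversed (opp d)) (reversed d) => [] [] // e; case: (@opp_neq G d).
Qed.

End Orientation.

(** * The description read off from a complex, and the isomorphism *)

Section Describe.
Variable Y : complex2.
Hypothesis face_Y : inhabited (face Y).

Definition boundary_word (F : face Y) : seq (quot (@opposite Y) * bool) :=
  [seq (edge_of (bd j), reversed (bd j)) | j <- enum 'I_(perim F)].

Lemma size_boundary_word (F : face Y) : size (boundary_word F) = perim F.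
Proof. by rewrite size_map size_enum_ord. Qed.

Lemma boundary_word_gt0 (F : face Y) : 0 < size (boundary_word F).
Proof. by rewrite size_boundary_word perim_gt0. Qed.

Definition describe : description := Description face_Y boundary_word_gt0.

Local Notation P := (word_polygons describe).

(** The length of a boundary word equals [perim F] only up to a proved equation, hence the cast. *)
Definition corner_of (v : vertex P) : vertex (polygons_of Y) :=
  existT _ (tag v) (cast_ord (size_boundary_word (tag v)) (tagged v)).

Definition dart_of (d : dart P) : dart (polygons_of Y) := (corner_of d.1, d.2).

Lemma corner_of_bij : bijective corner_of.
Proof.
exists (fun v => existT _ (tag v)
  (cast_ord (esym (size_boundary_word (tag v))) (tagged v))).
- by case=> F j; rewrite /corner_of /= cast_ordK.
- by case=> F j; rewrite /corner_of /= cast_ordKV.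
Qed.

Lemma dart_of_surj (d : dart (polygons_of Y)) : exists c, dart_of c = d.
Proof.
have [g _ gK] := corner_of_bij; case: d => v b.
by exists (g v, b); rewrite /dart_of /= gK.
Qed.

Lemma src_dart_of (d : dart P) : src (dart_of d) = corner_of (src d).
Proof.
case: d => -[F j] [] //.
apply: (congr1 (existT (fun F => 'I_(perim F)) F)).
exact: (ordS_cast_ord (size_boundary_word F) j).
Qed.

Definition glued_dart (d : dart P) : dart Y := attach_dart (dart_of d).
Definition glued_vertex (v : vertex P) : vertex Y := attach_vertex (corner_of v).

Lemma glued_src (d : dart P) : src (glued_dart d) = glued_vertex (src d).
Proof. by rewrite /glued_dart attach_src src_dart_of. Qed.

Lemma glued_opp (d : dart P) : glued_dart (opp d) = opp (glued_dart d).
Proof. exact: attach_opp (dart_of d). Qed.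

Lemma letterE (e : vertex P) :
  letter e = (edge_of (glued_dart (e, false)), reversed (glued_dart (e, false))).
Proof.
case: e => F j; set k := cast_ord (size_boundary_word F) j.
(* The default values are never read, since [j] is a valid position of the word. *)
rewrite /letter (tnth_nth (edge_of (bd k), false)) /=.
rewrite (nth_map k) ?size_enum_ord -?size_boundary_word //.
by rewrite (nth_ord_enum k k).
Qed.

(** An inverse letter is read exactly where the boundary runs against the chosen dart, so orienting
    by the letter restores that dart, which depends on the label alone. *)
Lemma glued_oriented (e : vertex P) : glued_dart (oriented e) = rep (label e).
Proof.
rewrite /label /oriented letterE rep_edge_of.
by case: reversed.
Qed.

Lemma dart_glue_glued (d d' : dart P) :
  dart_glue d d' -> glued_dart d = glued_dart d'.
Proof.
by case=> e [e' [ee' [[-> ->]|[-> ->]]]]; rewrite ?glued_opp !glued_oriented ee'.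
Qed.

Lemma vertex_glue_glued (v v' : vertex P) :
  vertex_glue v v' -> glued_vertex v = glued_vertex v'.
Proof.
by move=> /vertex_glueE [d [d' [<- <- /dart_glue_glued dd']]]; rewrite -!glued_src dd'.
Qed.

Lemma reversed_glued (d : dart P) :
  reversed (glued_dart d) = d.2 (+) (letter d.1).2.
Proof.
by case: d => e [] /=; rewrite letterE //= -reversed_opp -glued_opp.
Qed.

Lemma edge_of_glued (d : dart P) : edge_of (glued_dart d) = label d.1.
Proof.
by case: d => e []; rewrite /label letterE //= -edge_of_opp -glued_opp.
Qed.

(** Equal images have the same edge, hence equal labels, and the same value of [reversed], so both
    darts follow their labels or both oppose them. *)
Lemma glued_dart_glue (d d' : dart P) :
  glued_dart d = glued_dart d' -> dart_glue d d'.
Proof.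
move=> dd'; exists d.1, d'.1; split; first by rewrite -!edge_of_glued dd'.
have := congr1 (@reversed Y) dd'; rewrite !reversed_glued /oriented.
case: d d' {dd'} => [e b] [e' b'] /=.
by case: b b' (letter e).2 (letter e').2 => [] [] [] [] // _;
  first [by left | by right].
Qed.

Definition from_built_vertex (v : vertex (built describe)) : vertex Y :=
  glued_vertex (rep v).
Definition from_built_dart (d : dart (built describe)) : dart Y :=
  glued_dart (rep d).

Lemma from_built_vertexE (v : vertex P) :
  from_built_vertex (cls (@vertex_glue describe) v) = glued_vertex v.
Proof. exact: clos_rst_image vertex_glue_glued _ _ (rep_cls _ _). Qed.

Lemma from_built_dartE (d : dart P) :
  from_built_dart (cls (@dart_glue describe) d) = glued_dart d.
Proof. exact: clos_rst_image dart_glue_glued _ _ (rep_cls _ _). Qed.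

Lemma from_built_src (d : dart (built describe)) :
  src (from_built_dart d) = from_built_vertex (src d).
Proof. by rewrite -[d]repK from_built_dartE glued_src /= built_srcE from_built_vertexE. Qed.

Lemma from_built_opp (d : dart (built describe)) :
  from_built_dart (opp d) = opp (from_built_dart d).
Proof. by rewrite -[d]repK /= built_oppE !from_built_dartE glued_opp. Qed.

Lemma from_built_bd (F : face (built describe)) : exists k : nat,
  let s := [seq from_built_dart d | d <- codom (@bd (built describe) F)] in
  let t := codom (@bd Y F) in
  s = rot k t \/ s = rot k (inverse_path t).
Proof.
(* Each word is read from vertex 0 along [bd], so neither rotation nor reversal occurs. *)
exists 0; left; rewrite rot0 -(codom_cast_ord (size_boundary_word F)).
rewrite !codomE -map_comp; apply: eq_map => j /=.
by rewrite /built_bd from_built_dartE.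
Qed.

Definition from_built : cmap (built describe) Y :=
  CMap from_built_src from_built_opp from_built_bd.

Hypothesis Y_quot : polygon_quotient Y.

Lemma from_built_dart_bij : bijective from_built_dart.
Proof.
apply: inj_surj_bij => [d d'|d].
- rewrite -[d]repK -[d']repK !from_built_dartE => dd'.
  exact/clsP/rst_step/glued_dart_glue.
- have [p <-] := attach_dart_surj Y_quot d; have [c <-] := dart_of_surj p.
  by exists (cls _ c); rewrite from_built_dartE.
Qed.

Hypothesis Y_links : forall u : vertex Y, graph_connected (link u).

(** As [u] is not isolated, it is the source of a dart, and that dart has a preimage. *)
Lemma from_built_vertex_surj (u : vertex Y) : exists v, from_built_vertex v = u.
Proof.
have [d <-] := Y_quot.1 u; have [g _ gK] := from_built_dart_bij.
by exists (src (g d)); rewrite -from_built_src gK.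
Qed.

(* Identified ends come from identified darts, hence start at identified
   corners, and an edge of the link joins two ends at the same corner. *)
Lemma link_path_vertex_glue (u : vertex Y) (x y : vertex (link u))
    (c d : dart P) :
  clos_refl_trans _ (@adjacent (link u)) x y ->
  dmap (attach Y) (sval (rep x)) = glued_dart c ->
  dmap (attach Y) (sval (rep y)) = glued_dart d ->
  cls (@vertex_glue describe) (src c) = cls (@vertex_glue describe) (src d).
Proof.
have glued_src_inj (a b : dart P) : glued_dart a = glued_dart b ->
    cls (@vertex_glue describe) (src a) = cls (@vertex_glue describe) (src b).
  by move=> ab; apply/clsP/dart_glue_src/rst_step/glued_dart_glue.
move=> xy; elim: xy c d => {x y} [x y xy|x|x y z _ IHx _ IHy] c d.
- case: xy => -[v b] [<- <-] xc yd.
  have endE (b' : bool) : exists a : dart P,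
      dart_of a = corner_end (sval v) b' /\ corner_of (src a) = sval v.
    have [a aE] := dart_of_surj (corner_end (sval v) b').
    by exists a; rewrite -src_dart_of aE; split=> //; apply/corner_endP; exists b'.
  have [[a [aE av]] [a' [a'E a'v]]] := (endE b, endE (~~ b)).
  have ac : glued_dart a = glued_dart c.
    rewrite /glued_dart aE.
    exact: etrans (esym (rep_same_end (link_corner_end v b))) xc.
  have a'd : glued_dart a' = glued_dart d.
    rewrite /glued_dart a'E.
    exact: etrans (esym (rep_same_end (link_corner_end v (~~ b)))) yd.
  rewrite -(glued_src_inj _ _ ac) -(glued_src_inj _ _ a'd).
  suff -> : src a = src a' by [].
  by apply: (bij_inj corner_of_bij); rewrite av a'v.
- by move=> -> /glued_src_inj.
(* The dart [p] lies over the middle vertex [y] of the path and links the two induction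
   hypotheses. *)
- have [p pE] := dart_of_surj (sval (rep y)).
  move=> xc zd; rewrite (IHx c p) ?(IHy p d) //; by rewrite -pE.
Qed.

(** For injectivity, two corners over the same vertex each give an end in its link; a path joining
    these ends forces the corners to be identified. *)
Lemma from_built_vertex_bij : bijective from_built_vertex.
Proof.
apply: inj_surj_bij => [q q'|]; last exact: from_built_vertex_surj.
rewrite -[q]repK -[q']repK !from_built_vertexE => vv'.
have end_u (v : vertex P) : glued_vertex v = glued_vertex (rep q) ->
    vmap (attach Y) (src (dart_of (v, false))) = glued_vertex (rep q) by [].
pose l : link_end _ := exist _ _ (end_u _ erefl).
pose l' : link_end _ := exist _ _ (end_u _ (esym vv')).
have [_ /(_ (cls (@same_end Y _) l) (cls (@same_end Y _) l')) ll'] :=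
  Y_links (glued_vertex (rep q)).
by apply: (link_path_vertex_glue (c := (rep q, false)) (d := (rep q', false)) ll');
  rewrite rep_same_end.
Qed.

Lemma built_describe_isomorphic : isomorphic (built describe) Y.
Proof.
exists from_built; split.
- exact: from_built_vertex_bij.
- exact: from_built_dart_bij.
- by exists id.
Qed.

End Describe.

Theorem theorem2p5 :
  (forall R : description, link_connected (built R)) /\
  (forall Y : complex2, link_connected Y ->
     exists R : description, isomorphic (built R) Y).
Proof.
split=> [R|Y [face_Y Y_quot Y_links]]; first exact: built_link_connected.
by exists (describe face_Y); exact: built_describe_isomorphic.
Qed.
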